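(* Let $(\mathbb{R}^{2n},\omega)$ be the standard symplectic vector space with linear symplectic group $\mathrm{Sp}(n)$, let $R=\begin{pmatrix}\mathbb{1}&0\\0&-\mathbb{1}\end{pmatrix}$ with respect to the splitting $\mathbb{R}^{2n}=\mathbb{R}^n\oplus\mathbb{R}^n$, and let $\mathrm{Sp}^R(n)=\{\psi\in\mathrm{Sp}(n)\mid \psi=R\psi^{-1}R\}$. Then for every $\phi\in\mathrm{Sp}(n)$ there exists $\psi\in\mathrm{Sp}(n)$ with $\psi\phi\psi^{-1}\in\mathrm{Sp}^R(n)$.
   Context: $\omega$ is the standard symplectic form on $\mathbb{R}^{2n}=\mathbb{R}^n\oplus\mathbb{R}^n$, for which both factors are Lagrangian (standard splitting $\mathbb{R}^{2n}\cong T^*\mathbb{R}^n$); $\mathrm{Sp}(n)$ is the group of linear maps of $\mathbb{R}^{2n}$ preserving $\omega$. *)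

(* Defs.v *)
From HB Require Import structures.
From mathcomp Require Import all_boot all_order all_algebra.
From mathcomp Require Import reals.
Set Implicit Arguments. Unset Strict Implicit. Unset Printing Implicit Defensive.
Import Order.TTheory GRing.Theory Num.Theory.
Local Open Scope ring_scope.

(* Standard symplectic matrix on R^(2n) = R^n (+) R^n:
   omega(x, y) = x^T J y with J = [[0, 1], [-1, 0]]; both summands Lagrangian. *)
Definition Jstd (R : realType) (n : nat) : 'M[R]_(n + n) :=
  block_mx 0 1%:M (- 1%:M) 0.

Definition symplectic (R : realType) (n : nat) (A : 'M[R]_(n + n)) : Prop :=
  A^T *m Jstd R n *m A = Jstd R n.

Definition Rrefl (R : realType) (n : nat) : 'M[R]_(n + n) :=
  block_mx 1%:M 0 0 (- 1%:M).

Definition SpR (R : realType) (n : nat) (A : 'M[R]_(n + n)) : Prop :=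
  symplectic A /\ A = Rrefl R n *m invmx A *m Rrefl R n.

(* Main.v *)
Require Import Defs.
From HB Require Import structures.
From mathcomp Require Import all_boot all_order all_algebra.
From mathcomp Require Import reals.
From mathcomp Require Import boolp ring.
Set Implicit Arguments. Unset Strict Implicit. Unset Printing Implicit Defensive.
Import GRing.Theory.
Local Open Scope ring_scope.

(** A matrix [A] preserving the form [J] is governed by the self-adjoint
    [T = A + A^-1] and the skew-adjoint [D = A - A^-1], which commute and satisfy
    [D^2 = T^2 - 4]. It suffices to split the space into two Lagrangians that are
    [T]-stable and exchanged by [D]: in an adapted symplectic basis [R] commutes
    with [T] and anticommutes with [D], so it conjugates [A] to [A^-1].

    The splitting is built by peeling off nondegenerate stable pieces. Let
    [p^(k+1) r] be the minimal polynomial of [T] on what remains, [p] irreducible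
    and prime to [r]. If [p^k r^2 D] is nonzero there, polarization gives [x], killed
    by [p^(k+1)], with [w (x p^k D, x) <> 0], and the piece is
    [F[T] x + F[T] D x]. Otherwise [p] divides [X^2 - 4] exactly once, and one
    chooses [x, y], killed by [p^(k+1)] and by [p^k D], with [w (x p^k, y) <> 0]
    and [F[T] x] orthogonal to [D y]; the piece is the sum of [F[T] x + F[T] D y]
    and [F[T] y + F[T] D x]. All the cyclic spaces [F[T] x] are automatically
    isotropic because [T] is self-adjoint for an alternating form. *)

(** * Powers of irreducible polynomials over a field *)

Section IrreducibleFactors.
Variable F : fieldType.
Implicit Types a m p q r : {poly F}.

Lemma irreducible_coprimep p a :
  irreducible_poly p -> ~~ (p %| a) -> coprimep p a.
Proof.
move=> irr_p; apply: contraR; rewrite coprimep_def => ncop.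
have /eqp_dvdl <- := irr_p.2 _ ncop (dvdp_gcdl p a).
exact: dvdp_gcdr.
Qed.

Lemma irreducible_factor_exists m :
  (1 < size m)%N -> exists2 p, irreducible_poly p & p %| m.
Proof.
move=> m_gt1.
pose P k := `[< exists q, [/\ size q = k, (1 < k)%N & q %| m] >].
have exP : exists k, P k by exists (size m); apply/asboolP; exists m.
case: (ex_minnP exP) => k /asboolP[p [sp k_gt1 dvd_pm]] min_k.
exists p => //; split=> [|q sq dvd_qp]; first by rewrite sp.
have p0 : p != 0 by rewrite -size_poly_gt0 sp; apply: ltn_trans k_gt1.
have q0 : q != 0 by apply: contraTneq dvd_qp => ->; rewrite dvd0p.
rewrite -dvdp_size_eqp // eqn_leq dvdp_leq //= sp; apply: min_k.
apply/asboolP; exists q; split=> //; last exact: dvdp_trans dvd_qp dvd_pm.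
by rewrite ltn_neqAle eq_sym sq size_poly_gt0.
Qed.

Lemma irreducible_factor_power p m : irreducible_poly p -> m != 0 ->
  exists k r, m = p ^+ k * r /\ coprimep p r.
Proof.
move=> irr_p; have [s] := ubnP (size m); elim: s m => // s IHs m ltms m0.
have [/dvdpP[m' def_m]|/(irreducible_coprimep irr_p) cop] := boolP (p %| m);
  last by exists 0, m; rewrite mul1r.
have p0 := irredp_neq0 irr_p.
have m'0 : m' != 0 by apply: contraNneq m0 => m'0; rewrite def_m m'0 mul0r.
have [|k [r [def_m' cop]]] := IHs m' _ m'0.
  rewrite -ltnS; apply: leq_trans ltms; rewrite def_m size_mul // ltnS.
  by case: (size p) irr_p.1 => [|[|j]] // _; rewrite !addnS /= ltnS leq_addr.
by exists k.+1, r; split=> //; rewrite def_m def_m' exprS; ring.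
Qed.

(** The gcd of [a] and [p ^+ k.+1] is a power of [p] with exponent at most [k]. On a vector killed
    by [p ^+ k.+1], some multiple of [a] therefore acts as [p ^+ k], which is where the form is
    tested. *)
Lemma bezout_irreducible_power p k a : irreducible_poly p ->
  ~~ (p ^+ k.+1 %| a) -> exists u v, u * a + v * p ^+ k.+1 = p ^+ k.
Proof.
move=> irr_p; have p0 := irredp_neq0 irr_p.
elim: k a => [|k IHk] a ndv; last have [/dvdpP[a' def_a]|ndvpa] := boolP (p %| a).
- have /Bezout_eq1_coprimepP[[u v] /= uv] := irreducible_coprimep irr_p ndv.
  by exists v, u; rewrite addrC.
- have [|u [v uv]] := IHk a'.
    by move: ndv; rewrite def_a exprSr dvdp_mul2r.
  by exists u, v; rewrite [p ^+ k.+1]exprSr -uv def_a exprSr; ring.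
have : coprimep (p ^+ k.+2) a.
  exact/coprimep_expl/irreducible_coprimep.
case/Bezout_eq1_coprimepP=> -[u v] /= uv.
by exists (v * p ^+ k.+1), (u * p ^+ k.+1); rewrite -[RHS]mul1r -uv; ring.
Qed.

(** Away from characteristic 2 this polynomial is squarefree: a repeated factor divides the
    derivative, hence ['X], hence the constant 4. *)
Lemma irreducible_dvd_subX2_4 p q : (2 : F) != 0 -> irreducible_poly p ->
  'X^2 - 4%:P = p * q -> coprimep p q.
Proof.
move=> two0 irr_p def_pq; apply: (irreducible_coprimep irr_p); apply/negP.
case/dvdpP=> s def_q.
have pdX : p %| 'X.
  have: p %| ('X^2 - 4%:P)^`().
    rewrite def_pq def_q [s * p]mulrC derivM.
    by rewrite dvdp_add ?(dvdp_mulr _ (dvdpp p)) // dvdp_mull ?dvdp_mulr.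
  by rewrite derivB derivC subr0 derivXn -scaler_nat dvdpZr.
have: p %| 4%:P.
  rewrite -[4%:P](subKr 'X^2) def_pq dvdp_sub //; last by rewrite dvdp_mulr.
  by rewrite expr2 dvdp_mulr.
have ->: (4 : F) = 2 * 2 by ring.
move/(dvdp_leq _); rewrite polyC_eq0 mulf_neq0 // => /(_ isT).
by rewrite size_polyC mulf_neq0 // leqNgt irr_p.1.
Qed.

End IrreducibleFactors.

(** * Skew bilinear forms, evaluated on row vectors and row spaces *)

Section BilinearForm.
Variables (F : fieldType) (n : nat) (J : 'M[F]_n).
Hypothesis J_skew : J^T = - J.

Local Notation "''w' ( u , v )" := (u *m J *m v^T)
  (at level 8, format "''w' ( u ,  v )").

Lemma form_skew m1 m2 (u : 'M_(m1, n)) (v : 'M_(m2, n)) :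
  'w(v, u) = - 'w(u, v)^T.
Proof. by rewrite !trmx_mul trmxK J_skew mulNmx mulmxN opprK mulmxA. Qed.

Lemma form_skew_rV (u v : 'rV_n) : 'w(v, u) = - 'w(u, v).
Proof.
rewrite form_skew.
by rewrite {1}(mx11_scalar 'w(u, v)) tr_scalar_mx -mx11_scalar.
Qed.

Lemma form_sub m1 m2 m3 m4 (A : 'M_(m1, n)) (A' : 'M_(m2, n))
    (B : 'M_(m3, n)) (B' : 'M_(m4, n)) :
  (A <= A')%MS -> (B <= B')%MS -> 'w(A', B') = 0 -> 'w(A, B) = 0.
Proof.
move=> /submxP[C ->] /submxP[E ->] wAB.
by rewrite trmx_mul mulmxA -(mulmxA C) -(mulmxA C) wAB mulmx0 mul0mx.
Qed.

Lemma form_eq0P m1 m2 (A : 'M_(m1, n)) (B : 'M_(m2, n)) :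
  (forall u v : 'rV_n, (u <= A)%MS -> (v <= B)%MS -> 'w(u, v) = 0) ->
  'w(A, B) = 0.
Proof.
move=> wAB; apply/row_matrixP=> i; rewrite row0 !row_mul.
apply/trmx_inj/row_matrixP=> j; rewrite trmx0 row0 trmx_mul trmxK row_mul.
apply/trmx_inj; rewrite trmx_mul trmxK trmx0.
exact/wAB/row_sub/row_sub.
Qed.

Lemma form_addsmx m m1 m2 (u : 'M_(m, n)) (A : 'M_(m1, n)) (B : 'M_(m2, n)) :
  'w(u, A) = 0 -> 'w(u, B) = 0 -> 'w(u, (A + B)%MS) = 0.
Proof.
move=> uA uB; apply: form_eq0P => v _ vu /sub_addsmxP[[a b] /= ->].
rewrite linearD /= !trmx_mul mulmxDr !mulmxA.
by rewrite (form_sub vu (submx_refl A)) // (form_sub vu (submx_refl B)) // !mul0mx addr0.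
Qed.

Lemma form_addsmx_self m1 m2 (A : 'M_(m1, n)) (B : 'M_(m2, n)) :
    'w(A, A) = 0 -> 'w(B, B) = 0 -> 'w(B, A) = 0 ->
  'w((A + B)%MS, (A + B)%MS) = 0.
Proof.
move=> AA BB BA; have AB : 'w(A, B) = 0 by rewrite form_skew BA trmx0 oppr0.
by apply: form_addsmx; rewrite form_skew form_addsmx // trmx0 oppr0.
Qed.

End BilinearForm.

(** * The action of [F[T]] and the splittings exchanged by [D] *)

Section SwappedSplittings.
Variables (F : fieldType) (n' : nat).
Local Notation n := n'.+1.
Variables J T D : 'M[F]_n.
Hypothesis two_neq0 : (2 : F) != 0.
Hypothesis J_skew : J^T = - J.
Hypothesis J_unit : J \in unitmx.
Hypothesis T_selfadjoint : T *m J = J *m T^T.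
Hypothesis D_skewadjoint : D *m J = - (J *m D^T).
Hypothesis TD_comm : T *m D = D *m T.
Hypothesis D_square : D *m D = horner_mx T ('X^2 - 4%:P).

Implicit Types a b c e g : {poly F}.

Local Notation "''w' ( u , v )" := (u *m J *m v^T)
  (at level 8, format "''w' ( u ,  v )").
Local Notation "x *h a" := (x *m horner_mx T a)
  (at level 40, left associativity).

Lemma actM m (x : 'M_(m, n)) a b : x *h (a * b) = x *h a *h b.
Proof. by rewrite rmorphM /= -mulmxE mulmxA. Qed.

Lemma actD m (x : 'M_(m, n)) a b : x *h (a + b) = x *h a + x *h b.
Proof. by rewrite rmorphD mulmxDr. Qed.

Lemma act1 m (x : 'M_(m, n)) : x *h 1 = x.
Proof. by rewrite rmorph1 mulmx1. Qed.

Lemma act_D m (x : 'M_(m, n)) a : x *h a *m D = x *m D *h a.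
Proof. by rewrite -!mulmxA (comm_horner_mx a TD_comm). Qed.

Lemma act_DD m (x : 'M_(m, n)) : x *m D *m D = x *h ('X^2 - 4%:P).
Proof. by rewrite -mulmxA D_square. Qed.

Lemma form_act m1 m2 (x : 'M_(m1, n)) (y : 'M_(m2, n)) a :
  'w(x *h a, y) = 'w(x, y *h a).
Proof.
rewrite trmx_mul mulmxA; congr (_ *m _); rewrite -!mulmxA; congr (_ *m _).
elim/poly_ind: a => [|a c IHa]; first by rewrite rmorph0 trmx0 mulmx0 mul0mx.
rewrite rmorphD rmorphM /= horner_mx_X horner_mx_C -mulmxE.
rewrite linearD /= tr_scalar_mx mulmxDl mulmxDr trmx_mul.
rewrite scalar_mxC; congr (_ + _).
have -> : horner_mx T a *m T = T *m horner_mx T a.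
  exact: (comm_horner_mx a (erefl (T *m T))).
by rewrite -mulmxA IHa !mulmxA T_selfadjoint.
Qed.

Lemma form_D m1 m2 (x : 'M_(m1, n)) (y : 'M_(m2, n)) :
  'w(x *m D, y) = - 'w(x, y *m D).
Proof.
by rewrite trmx_mul -(mulmxA x) D_skewadjoint mulmxN mulNmx !mulmxA.
Qed.

Lemma eq_oppmx m1 m2 (A : 'M[F]_(m1, m2)) : A = - A -> A = 0.
Proof.
move/eqP; rewrite -addr_eq0 -mulr2n -scaler_nat scaler_eq0 (negPf two_neq0).
by move/eqP.
Qed.

(** With both polynomials moved to one side, [w(x, x c) = w(x c, x) = - w(x, x c)]. *)
Lemma form_act_self (x : 'rV_n) a b : 'w(x *h a, x *h b) = 0.
Proof.
rewrite form_act -actM; apply: eq_oppmx.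
by rewrite -{1}form_act (form_skew_rV J_skew).
Qed.

(** The rows are [x T^i] for [i < n]; by Cayley-Hamilton they span all of [F[T] x]. *)
Definition cyclic_span (x : 'rV_n) : 'M_n :=
  powers_mx T n *m lin_mul_row x.

Lemma cyclic_spanP (v x : 'rV_n) :
  reflect (exists a, v = x *h a) (v <= cyclic_span x)%MS.
Proof.
apply: (iffP submxP) => [[u ->] | [a ->]].
  exists (rVpoly u); rewrite horner_rVpoly mulmxA.
  by rewrite -[u *m _ in LHS]vec_mxK mul_vec_lin_row.
exists (poly_rV (a %% char_poly T)).
rewrite mulmxA -[_ *m powers_mx _ _]vec_mxK mul_vec_lin_row -horner_rVpoly.
rewrite poly_rV_K; last first.
  rewrite -ltnS -(size_char_poly T) ltn_modp.
  by rewrite -size_poly_gt0 size_char_poly.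
congr (_ *m _); rewrite {1}(divp_eq a (char_poly T)) rmorphD rmorphM /=.
by rewrite Cayley_Hamilton mulr0 add0r.
Qed.

Definition swapped_span (x y : 'rV_n) : 'M_n :=
  (cyclic_span x + cyclic_span (y *m D))%MS.

Lemma swapped_spanP (v x y : 'rV_n) :
  reflect (exists a b, v = x *h a + y *h b *m D) (v <= swapped_span x y)%MS.
Proof.
apply: (iffP sub_addsmxP) => [[[u1 u2] /= ->] | [a [b ->]]].
  have /cyclic_spanP[a ->] := submxMl u1 (cyclic_span x).
  have /cyclic_spanP[b ->] := submxMl u2 (cyclic_span (y *m D)).
  by exists a, b; rewrite act_D.
have /submxP[u1 ->] : (x *h a <= cyclic_span x)%MS.
  by apply/cyclic_spanP; exists a.
have /submxP[u2 ->] : (y *h b *m D <= cyclic_span (y *m D))%MS.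
  by apply/cyclic_spanP; exists b; rewrite act_D.
by exists (u1, u2).
Qed.

Definition swapped_splitting (P Q : 'M[F]_n) : Prop :=
  [/\ stablemx P T, stablemx Q T, (P *m D <= Q)%MS & (Q *m D <= P)%MS] /\
  ('w(P, P) = 0 /\ 'w(Q, Q) = 0).

Definition nondegenerate (U : 'M[F]_n) : Prop :=
  forall v : 'rV_n, (v <= U)%MS -> 'w(v, U) = 0 -> v = 0.

Lemma submx_mulP (A B C : 'M[F]_n) :
  (forall v : 'rV_n, (v <= A)%MS -> (v *m C <= B)%MS) -> (A *m C <= B)%MS.
Proof. by move=> AB; apply/row_subP=> i; rewrite row_mul AB ?row_sub. Qed.

(** Since [D] commutes with [T] and squares to [T^2 - 4], it maps [F[T] x] into [F[T] x D] and [F[T]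
    y D] into [F[T] y]. Cyclic spaces being isotropic, only the cross terms need the hypothesis. *)
Lemma swapped_span_splitting (x y : 'rV_n) :
  (forall c, 'w(x *h c, y *m D) = 0) ->
  swapped_splitting (swapped_span x y) (swapped_span y x).
Proof.
have actX (v : 'rV_n) : v *m T = v *h 'X by rewrite horner_mx_X.
have stT x1 y1 : stablemx (swapped_span x1 y1) T.
  apply: submx_mulP => v /swapped_spanP[a [b ->]]; apply/swapped_spanP.
  by exists (a * 'X), (b * 'X); rewrite mulmxDl !actX !actM !act_D.
have stD x1 y1 : (swapped_span x1 y1 *m D <= swapped_span y1 x1)%MS.
  apply: submx_mulP => v /swapped_spanP[a [b ->]]; apply/swapped_spanP.
  exists (b * ('X^2 - 4%:P)), a.
  by rewrite mulmxDl act_DD actM addrC.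
have iso x1 y1 : (forall c, 'w(x1 *h c, y1 *m D) = 0) ->
    'w(swapped_span x1 y1, swapped_span x1 y1) = 0.
  move=> xy; apply: form_eq0P=> _ _ /swapped_spanP[a [b ->]] /swapped_spanP[c [d ->]].
  have xy' e g : 'w(x1 *h e, y1 *h g *m D) = 0.
    by rewrite act_D -form_act -actM xy.
  have yx' e g : 'w(y1 *h g *m D, x1 *h e) = 0.
    by rewrite (form_skew_rV J_skew) xy' oppr0.
  rewrite linearD /= !(mulmxDl, mulmxDr) form_act_self xy' yx'.
  by rewrite !act_D form_act_self !addr0.
move=> xy; split; first by split.
split; apply: iso => // c.
(* The hypothesis is symmetric in [x] and [y]: the signs from the skew form and from the
   skew-adjoint [D] cancel. *)
by rewrite form_act -act_D -[LHS]opprK -form_D -(form_skew_rV J_skew) xy.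
Qed.

(** Isotropy puts both components of a radical vector into the radical: [u] is orthogonal to [P] by
    itself, hence so is [v], and likewise for [Q]. *)
Lemma splitting_nondegenerate (P Q : 'M[F]_n) :
  swapped_splitting P Q ->
  (forall v : 'rV_n, (v <= P)%MS -> 'w(v, (P + Q)%MS) = 0 -> v = 0) ->
  (forall v : 'rV_n, (v <= Q)%MS -> 'w(v, (P + Q)%MS) = 0 -> v = 0) ->
  nondegenerate (P + Q)%MS.
Proof.
move=> [_ [PP QQ]] radP radQ _ /sub_addsmxP[[c d] /= ->] rad.
set u := c *m P in rad *; set v := d *m Q in rad *.
have uP : (u <= P)%MS by rewrite submxMl.
have vQ : (v <= Q)%MS by rewrite submxMl.
have uPP : 'w(u, P) = 0 by apply: form_sub PP.
have vQQ : 'w(v, Q) = 0 by apply: form_sub QQ.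
have uQ : 'w(u, Q) = 0.
  by have := form_sub (submx_refl _) (addsmxSr P Q) rad; rewrite !mulmxDl vQQ addr0.
have vP : 'w(v, P) = 0.
  by have := form_sub (submx_refl _) (addsmxSl P Q) rad; rewrite !mulmxDl uPP add0r.
have -> : v = 0 by apply: radQ vQ _; apply: form_addsmx.
by rewrite addr0; apply: radP uP _; apply: form_addsmx.
Qed.

Lemma splitting_sum_stable (P Q : 'M[F]_n) : swapped_splitting P Q ->
  stablemx (P + Q)%MS T /\ stablemx (P + Q)%MS D.
Proof.
move=> [[PT QT PD QD] _]; rewrite !addsmxMr !addsmx_sub.
split; apply/andP; split.
- exact: submx_trans PT (addsmxSl _ _).
- exact: submx_trans QT (addsmxSr _ _).
- exact: submx_trans PD (addsmxSr _ _).
- exact: submx_trans QD (addsmxSl _ _).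
Qed.

(** * Radicals, and nondegeneracy of the pieces with one or two generators *)

Lemma radical_act (W : 'M[F]_n) (v : 'rV_n) a :
  stablemx W T -> 'w(v, W) = 0 -> 'w(v *h a, W) = 0.
Proof.
move=> WT vW; rewrite form_act; apply: form_sub vW => //.
exact: horner_mx_stable.
Qed.

Lemma radical_D (W : 'M[F]_n) (v : 'rV_n) :
  stablemx W D -> 'w(v, W) = 0 -> 'w(v *m D, W) = 0.
Proof.
by move=> WD vW; rewrite form_D (form_sub _ WD vW) // oppr0.
Qed.


Lemma act_dvd m (v : 'M_(m, n)) a b : v *h a = 0 -> a %| b -> v *h b = 0.
Proof. by move=> va /dvdpP[c ->]; rewrite mulrC actM va mul0mx. Qed.

Lemma radical_power (W : 'M[F]_n) (v : 'rV_n) p k a : irreducible_poly p ->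
    stablemx W T -> v *h p ^+ k.+1 = 0 -> 'w(v *h a, W) = 0 ->
  ~~ (p ^+ k.+1 %| a) -> 'w(v *h p ^+ k, W) = 0.
Proof.
move=> irr_p WT vp va /(bezout_irreducible_power irr_p)[b [c <-]].
rewrite actD [c * _]mulrC [b * a]mulrC !actM vp mul0mx addr0.
exact: radical_act.
Qed.

(** With [x *m D] as second vector, [P] is just [F[T] x] and [Q] is [F[T] x D]. A nonzero radical
    vector in either would put [x p^k D] into the radical, against its pairing with [x]. *)
Lemma nonisotropic_nondegenerate p k (x : 'rV_n) :
    irreducible_poly p -> x *h p ^+ k.+1 = 0 -> 'w(x *h p ^+ k *m D, x) != 0 ->
  let P := swapped_span x (x *m D) in let Q := swapped_span (x *m D) x in
  swapped_splitting P Q /\ nondegenerate (P + Q)%MS.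
Proof.
move=> irr_p xp wx P Q.
have split_PQ : swapped_splitting P Q.
  by apply: swapped_span_splitting => c; rewrite act_DD form_act_self.
have [WT WD] := splitting_sum_stable split_PQ.
have xW : (x <= P + Q)%MS.
  apply: submx_trans (addsmxSl _ _); apply/swapped_spanP; exists 1, 0.
  by rewrite act1 rmorph0 mulmx0 mul0mx addr0.
have xDp : x *m D *h p ^+ k.+1 = 0 by rewrite -act_D xp mul0mx.
split=> //; apply: splitting_nondegenerate => // _ /swapped_spanP[a [b ->]].
  rewrite act_D act_DD -actM -actD => rad.
  apply: act_dvd (xp) _; apply: contraR wx.
  move/(radical_power irr_p WT xp rad)/(radical_D WD) => rad'.
  by apply/eqP; apply: form_sub rad'.
rewrite -act_D -mulmxDl -actD act_D => rad.
apply: act_dvd (xDp) _; apply: contraR wx.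
move/(radical_power irr_p WT xDp rad) => rad'.
by apply/eqP; rewrite act_D; apply: form_sub rad'.
Qed.

Lemma pair_radical p q k (x y : 'rV_n) (W : 'M[F]_n) :
    irreducible_poly p -> 'X^2 - 4%:P = p * q -> coprimep p q ->
    stablemx W T -> stablemx W D -> (x <= W)%MS -> (y <= W)%MS ->
    x *h p ^+ k.+1 = 0 -> y *h p ^+ k.+1 = 0 ->
    x *h p ^+ k *m D = 0 -> y *h p ^+ k *m D = 0 -> 'w(x *h p ^+ k, y) != 0 ->
  forall v : 'rV_n, (v <= swapped_span x y)%MS -> 'w(v, W) = 0 -> v = 0.
Proof.
move=> irr_p def_pq cop_pq WT WD xW yW xp yp xpD ypD wxy.
(* Here [y b D^2 = y (b p q)], and [p ^+ k.+1] must divide [b p q], since otherwise [y p^k] would be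
   radical, against [wxy]. As [p] is prime to [q], [p ^+ k] divides [b], and [ypD] applies. *)
have yD0 b : 'w(y *h b *m D *m D, W) = 0 -> y *h b *m D = 0.
  rewrite act_DD -actM def_pq => rad.
  suff /dvdpP[c ->] : p ^+ k %| b by rewrite mulrC actM act_D act_D -act_D ypD mul0mx.
  rewrite -(Gauss_dvdpl b (coprimep_expl k cop_pq)).
  rewrite -(dvdp_mul2r _ _ (irredp_neq0 irr_p)) -exprSr -mulrA [q * p]mulrC.
  apply: contraR wxy => /(radical_power irr_p WT yp rad) rad'.
  by rewrite form_act (form_skew_rV J_skew) (form_sub _ xW rad') // oppr0.
move=> _ /swapped_spanP[a [b ->]] rad.
(* Otherwise a multiple of the radical vector has first term [x p^k], which [D] kills; [yD0] then
   removes the second term and leaves [x p^k] in the radical. *)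
have dvd_a : p ^+ k.+1 %| a.
  apply: contraR wxy => /(bezout_irreducible_power irr_p)[u [s def_us]].
  have xus : x *h p ^+ k = x *h (a * u).
    by rewrite -def_us actD [s * _]mulrC (actM x _ s) xp mul0mx addr0 mulrC.
  have := radical_act u WT rad.
  rewrite mulmxDl -actM -xus -act_D -actM => rad_u.
  have := radical_D WD rad_u; rewrite mulmxDl xpD add0r => /yD0 ybuD.
  move: rad_u; rewrite ybuD addr0 => rad_u.
  by apply/eqP; apply: form_sub rad_u.
move: rad; rewrite (act_dvd xp dvd_a) add0r => rad.
exact/yD0/radical_D.
Qed.

Lemma pair_nondegenerate p q k (x y : 'rV_n) :
    irreducible_poly p -> 'X^2 - 4%:P = p * q ->
    x *h p ^+ k.+1 = 0 -> y *h p ^+ k.+1 = 0 ->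
    x *h p ^+ k *m D = 0 -> y *h p ^+ k *m D = 0 -> 'w(x *h p ^+ k, y) != 0 ->
    (forall c, 'w(x *h c, y *m D) = 0) ->
  let P := swapped_span x y in let Q := swapped_span y x in
  swapped_splitting P Q /\ nondegenerate (P + Q)%MS.
Proof.
move=> irr_p def_pq xp yp xpD ypD wxy wxyD P Q.
have cop_pq := irreducible_dvd_subX2_4 two_neq0 irr_p def_pq.
have split_PQ : swapped_splitting P Q by apply: swapped_span_splitting.
have [WT WD] := splitting_sum_stable split_PQ.
have gen x1 y1 : (x1 <= swapped_span x1 y1)%MS.
  apply/swapped_spanP; exists 1, 0.
  by rewrite act1 rmorph0 mulmx0 mul0mx addr0.
have xW : (x <= P + Q)%MS by rewrite (submx_trans (gen x y)) ?addsmxSl.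
have yW : (y <= P + Q)%MS by rewrite (submx_trans (gen y x)) ?addsmxSr.
split=> //; apply: splitting_nondegenerate => //.
  exact: (pair_radical irr_p def_pq cop_pq WT WD xW yW xp yp).
apply: (pair_radical irr_p def_pq cop_pq WT WD yW xW yp xp) => //.
by rewrite form_act (form_skew_rV J_skew) oppr_eq0.
Qed.

(** * Orthogonal complements and separation by the form *)

Definition orthogonal_mx (W : 'M[F]_n) : 'M_n := kermx (J *m W^T).

Lemma orthogonal_mxP m (A : 'M_(m, n)) W :
  reflect ('w(A, W) = 0) (A <= orthogonal_mx W)%MS.
Proof. by apply: (iffP sub_kermxP); rewrite mulmxA. Qed.

(** Invertibility of [J] gives the complement rank [n - \rank W], and nondegeneracy makes it meet
    [W] trivially. *)
Lemma nondegenerate_sum_orthogonal W : nondegenerate W ->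
  row_full (W + orthogonal_mx W)%MS.
Proof.
move=> ndW; have cap0 : (W :&: orthogonal_mx W)%MS = 0.
  apply/row_matrixP=> i; rewrite row0.
  have := row_sub i (W :&: orthogonal_mx W)%MS.
  by rewrite sub_capmx => /andP[sW /orthogonal_mxP]; apply: ndW.
have := mxrank_sum_cap W (orthogonal_mx W).
rewrite cap0 mxrank0 addn0 /orthogonal_mx mxrank_ker -(mxrank_tr (J *m _)).
rewrite trmx_mul trmxK mxrankMfree ?row_free_unit ?unitmx_tr // subnKC ?rank_leq_col //.
by move/eqP.
Qed.

(** Some column of the cokernel matrix of [Z] is a functional that vanishes on [Z] but not at [v].
    It is represented through [J] by a vector, whose component in [U] along the orthogonal
    complement has the same pairings with [U]. *)
Lemma separating_vector m (U : 'M[F]_n) (Z : 'M_(m, n)) (v : 'rV_n) :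
    nondegenerate U -> (Z <= U)%MS -> (v <= U)%MS -> ~~ (v <= Z)%MS ->
  exists y : 'rV_n, [/\ (y <= U)%MS, 'w(Z, y) = 0 & 'w(v, y) != 0].
Proof.
move=> ndU ZU vU; rewrite submxE => vZ.
have [j vj] : exists j, v *m col j (cokermx Z) != 0.
  apply/existsP; apply: contraR vZ => /existsPn vZ.
  apply/eqP/trmx_inj/row_matrixP=> j; rewrite trmx0 row0 -tr_col.
  have := vZ j; rewrite negbK !colE mulmxA => /eqP->.
  by rewrite trmx0.
pose y := (invmx J *m col j (cokermx Z))^T.
have wy m1 (A : 'M_(m1, n)) : 'w(A, y) = A *m col j (cokermx Z).
  by rewrite trmxK mulmxA mulmxK.
have /sub_addsmxP[[c d] /= def_y] := submx_full y (nondegenerate_sum_orthogonal ndU).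
have wy1 m1 (A : 'M_(m1, n)) : (A <= U)%MS -> 'w(A, c *m U) = 'w(A, y).
  move=> AU; rewrite def_y linearD mulmxDr /= -[LHS]addr0; congr (_ + _).
  rewrite (form_skew J_skew) (form_sub (submxMl d _) AU) ?trmx0 ?oppr0 //.
  exact/orthogonal_mxP.
exists (c *m U); split; first exact: submxMl.
  by rewrite wy1 // wy colE mulmxA mulmx_coker mul0mx.
by rewrite wy1 // wy.
Qed.

(** * Peeling off nondegenerate stable pieces *)

Lemma minimal_annihilator (U : 'M[F]_n) : U != 0 ->
  exists m : {poly F},
    [/\ (1 < size m)%N, U *h m = 0 & forall a, U *h a = 0 -> m %| a].
Proof.
move=> U0.
pose A k := `[< exists m : {poly F}, [/\ size m = k, m != 0 & U *h m = 0] >].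
have exA : exists k, A k.
  exists (size (char_poly T)); apply/asboolP; exists (char_poly T); split=> //.
    by rewrite -size_poly_gt0 size_char_poly.
  by rewrite Cayley_Hamilton mulmx0.
case: (ex_minnP exA) => k /asboolP[m [<- m0 Um]] min_m.
exists m; split=> // [|a Ua].
  rewrite ltnNge; apply: contra U0 => /size1_polyC def_m; move: Um m0.
  rewrite def_m horner_mx_C mul_mx_scalar polyC_eq0 => /eqP.
  by rewrite scaler_eq0 => /orP[->|].
apply/modp_eq0P/eqP; apply: contraT => am0.
suff : (size m <= size (a %% m)%R)%N by rewrite leqNgt ltn_modp m0.
apply: min_m; apply/asboolP; exists (a %% m); split=> //.
move: Ua; rewrite {1}(divp_eq a m) actD => <-.
by rewrite mulrC actM Um mul0mx add0r.
Qed.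

Lemma swapped_span_sub (U : 'M[F]_n) (x y : 'rV_n) :
    stablemx U T -> stablemx U D -> (x <= U)%MS -> (y <= U)%MS ->
  (swapped_span x y <= U)%MS.
Proof.
move=> UT UD xU yU; apply/rV_subP=> _ /swapped_spanP[a [b ->]].
have actU (v : 'rV_n) c : (v <= U)%MS -> (v *h c <= U)%MS.
  by move=> vU; apply: submx_trans (submxMr _ vU) (horner_mx_stable _ UT).
by rewrite addmx_sub ?actU // (submx_trans (submxMr _ (actU _ b yU))).
Qed.

(** Polarization: [w(x f D, y)] is symmetric in [x] and [y], because [D] and the form are both skew.
    If it vanished whenever [x = y], it would vanish on [U], and nondegeneracy would give
    [U f D = 0]. *)
Lemma exists_nonisotropic (U : 'M[F]_n) f :
    stablemx U T -> stablemx U D -> nondegenerate U -> U *h f *m D != 0 ->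
  exists2 x : 'rV_n, (x <= U)%MS & 'w(x *h f *m D, x) != 0.
Proof.
move=> UT UD ndU UfD; apply: contrapT => iso; case/negP: UfD; apply/eqP.
have iso0 (x : 'rV_n) : (x <= U)%MS -> 'w(x *h f *m D, x) = 0.
  by move=> xU; apply/eqP; apply/negPn/negP=> wx; apply: iso; exists x.
apply/row_matrixP=> i; rewrite row0 !row_mul; apply: ndU.
  apply: submx_trans (submxMr _ _) UD.
  by apply: submx_trans (submxMr _ (row_sub i U)) (horner_mx_stable _ UT).
apply: form_eq0P => u y ux yU; apply: (form_sub ux (submx_refl y)).
set x := row i U; have xU : (x <= U)%MS by rewrite row_sub.
have sym : 'w(y *h f *m D, x) = 'w(x *h f *m D, y).
  by rewrite form_D form_act -act_D (form_skew_rV J_skew) opprK.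
have := iso0 (x + y) (addmx_sub xU yU).
rewrite linearD /= !(mulmxDl, mulmxDr) !iso0 // sym add0r addr0.
by move/eqP; rewrite addr_eq0 => /eqP/eq_oppmx.
Qed.

Lemma splitting_piece (U : 'M[F]_n) :
    stablemx U T -> stablemx U D -> nondegenerate U -> U != 0 ->
  exists P Q, [/\ swapped_splitting P Q, (P + Q <= U)%MS,
    nondegenerate (P + Q)%MS & (P + Q)%MS != 0].
Proof.
move=> UT UD ndU /minimal_annihilator[m [m_gt1 Um min_m]].
have [p irr_p pm] := irreducible_factor_exists m_gt1.
have m0 : m != 0 by rewrite -size_poly_gt0 ltnW.
have [[|k] [r [def_m cop_pr]]] := irreducible_factor_power irr_p m0.
  move: pm; rewrite def_m mul1r => /dvdp_gcd_idl.
  move: cop_pr; rewrite coprimep_def => /eqP s1 /eqp_size; rewrite s1 => s1'.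
  by have := irr_p.1; rewrite -s1'.
(* With [min_m], this says that [p ^+ k] times a factor prime to [p] never annihilates [U]. *)
have ndv c : coprimep p c -> ~~ (m %| p ^+ k * c).
  move=> cop_pc; apply/negP=> dv.
  have: p ^+ k * p %| p ^+ k * c.
    by apply: dvdp_trans dv; rewrite def_m exprSr dvdp_mulr.
  rewrite dvdp_mul2l ?expf_neq0 ?(irredp_neq0 irr_p) // => /dvdp_gcd_idl /eqp_size.
  move: cop_pc; rewrite coprimep_def => /eqP-> s1.
  by have := irr_p.1; rewrite -s1.
have actU (v : 'rV_n) c : (v <= U)%MS -> (v *h c <= U)%MS.
  by move=> vU; apply: submx_trans (submxMr _ vU) (horner_mx_stable _ UT).
have act0 (v : 'rV_n) c : (v <= U)%MS -> m %| c -> v *h c = 0.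
  by move=> /submxP[e ->] mc; rewrite -mulmxA (act_dvd Um mc) mulmx0.
have spanU (x y : 'rV_n) : (x <= U)%MS -> (y <= U)%MS ->
    (swapped_span x y + swapped_span y x <= U)%MS.
  by move=> xU yU; rewrite addsmx_sub !swapped_span_sub.
have span0 (x y : 'rV_n) : x != 0 -> (swapped_span x y + swapped_span y x)%MS != 0.
  apply: contraNneq => W0; rewrite -submx0 -W0.
  apply: submx_trans (addsmxSl _ _); apply/swapped_spanP; exists 1, 0.
  by rewrite act1 rmorph0 mulmx0 mul0mx addr0.
(* [r] has to act on both arguments of the form, to move them into the
   [p]-primary part. *)
pose f := p ^+ k * r ^+ 2.
have [UfD|/exists_nonisotropic[] // x0 x0U wx0] := eqVneq (U *h f *m D) 0; last first.
  pose x := x0 *h r.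
  have wx : 'w(x *h p ^+ k *m D, x) != 0.
    rewrite -form_act /x -act_D -!actM; congr (_ != _): wx0.
    by congr ('w(_ *h _ *m D, _)); rewrite /f; ring.
  have xp : x *h p ^+ k.+1 = 0 by rewrite -actM act0 // def_m mulrC.
  have [split_PQ ndPQ] := nonisotropic_nondegenerate irr_p xp wx.
  have xU : (x <= U)%MS by apply: actU.
  exists (swapped_span x (x *m D)), (swapped_span (x *m D) x); split=> //.
    by rewrite spanU // (submx_trans (submxMr _ xU)).
  by apply: span0; apply: contraNneq wx => ->; rewrite trmx0 mulmx0.
have UfD0 (v : 'rV_n) : (v <= U)%MS -> v *h f *m D = 0.
  by move=> /submxP[e ->]; rewrite -!mulmxA [U *m _]mulmxA UfD mulmx0.
(* From [U f D^2 = 0], [m] divides [p^k r^2 (X^2 - 4)], so the missing factor [p] must come from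
   [X^2 - 4]. *)
have [q def_pq] : exists q, 'X^2 - 4%:P = p * q.
  suff /dvdpP[q ->] : p %| 'X^2 - 4%:P by exists q; rewrite mulrC.
  have: m %| f * ('X^2 - 4%:P).
    by apply: min_m; rewrite actM -act_DD UfD mul0mx.
  apply: contraTT => /(irreducible_coprimep irr_p) cop4.
  by rewrite /f -mulrA ndv // coprimepMr coprimep_expr.
have cop_pq := irreducible_dvd_subX2_4 two_neq0 irr_p def_pq.
(* The exponent 4 is shared out below: [x] and [y] receive [r ^+ 2] each, which makes [p^k D] kill
   both, and self-adjointness gathers the two factors in [z]. *)
have [i Ui] : exists i, row i U *h (p ^+ k * r ^+ 4) != 0.
  apply/existsP; apply: contraT => /existsPn Ui.
  case/negP: (ndv _ (coprimep_expr 4 cop_pr)); apply: min_m.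
  apply/row_matrixP=> i; rewrite row0 row_mul.
  by have := Ui i; rewrite negbK => /eqP.
set x0 := row i U in Ui; have x0U : (x0 <= U)%MS by rewrite row_sub.
pose z := x0 *h r ^+ 4; have zU : (z <= U)%MS by apply: actU.
have zpk : z *h p ^+ k != 0 by rewrite -actM mulrC.
have zp : z *h p ^+ k.+1 = 0.
  by rewrite -actM act0 // def_m mulrC dvdp_mul // exprS dvdp_mulr.
have zpD : z *h p ^+ k *m D = 0.
  have -> : z *h p ^+ k = x0 *h r ^+ 2 *h f by rewrite -!actM; congr (_ *h _); rewrite /f; ring.
  by rewrite UfD0 // actU.
(* If [z p^k = z c D], applying [D] gives [z (c p q) = 0], and [z p^k] being nonzero, [p ^+ k]
   divides [c]. But then [z c D] vanishes. *)
have zZ : ~~ (z *h p ^+ k <= cyclic_span (z *m D))%MS.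
  apply: contra (zpk) => /cyclic_spanP[c def_c].
  have pk_c : p ^+ k %| c.
    rewrite -(Gauss_dvdpl c (coprimep_expl k cop_pq)).
    rewrite -(dvdp_mul2r _ _ (irredp_neq0 irr_p)) -exprSr -mulrA [q * p]mulrC.
    apply: contraTT isT => /(bezout_irreducible_power irr_p)[u [v def_uv]].
    case/negP: zpk; rewrite -def_uv actD [u * _]mulrC (actM z _ u) (mulrC v) (actM z _ v).
    by rewrite -def_pq (mulrC c) actM -act_DD -act_D -def_c zpD zp !mul0mx addr0.
  by rewrite def_c -act_D; case/dvdpP: pk_c => d ->; rewrite mulrC actM act_D zpD mul0mx.
have ZU : (cyclic_span (z *m D) <= U)%MS.
  by rewrite (submx_trans _ (swapped_span_sub UT UD zU zU)) // addsmxSr.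
(* Here [wz] will become the nonzero pairing [wxy], and [wZ] the orthogonality [wxyD]. *)
have [y0 [y0U wZ wz]] := separating_vector ndU ZU (actU _ _ zU) zZ.
pose x := x0 *h r ^+ 2; pose y := y0 *h r ^+ 2.
have xU : (x <= U)%MS by apply: actU.
have yU : (y <= U)%MS by apply: actU.
have wxy : 'w(x *h p ^+ k, y) != 0.
  rewrite -form_act -!actM; congr (_ != _): wz.
  by rewrite -actM; congr ('w(_ *h _, _)); ring.
have killp (v : 'rV_n) : (v <= U)%MS -> v *h r ^+ 2 *h p ^+ k.+1 = 0.
  by move=> vU; rewrite -actM act0 // def_m mulrC dvdp_mul // exprS dvdp_mulr.
have killD (v : 'rV_n) : (v <= U)%MS -> v *h r ^+ 2 *h p ^+ k *m D = 0.
  by move=> vU; rewrite -actM mulrC UfD0.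
have wxyD c : 'w(x *h c, y *m D) = 0.
  rewrite act_D -form_act -!actM -[LHS]opprK -form_D.
  rewrite (form_sub _ (submx_refl _) wZ) ?oppr0 //.
  apply/cyclic_spanP; exists c; rewrite -act_D -actM; congr (_ *h _ *m _); ring.
have [split_PQ ndPQ] := pair_nondegenerate irr_p def_pq
  (killp _ x0U) (killp _ y0U) (killD _ x0U) (killD _ y0U) wxy wxyD.
exists (swapped_span x y), (swapped_span y x); split=> //; first exact: spanU.
by apply: span0; apply: contraNneq wxy => ->; rewrite !mul0mx.
Qed.

(** Induction on the rank: a piece [W] is split off, and its orthogonal complement in [U] is again
    stable by adjointness. Orthogonality of the two parts keeps the summed halves isotropic. *)
Lemma swapped_splitting_exists (U : 'M[F]_n) :
    stablemx U T -> stablemx U D -> nondegenerate U ->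
  exists P Q, swapped_splitting P Q /\ (P + Q :=: U)%MS.
Proof.
have [s] := ubnP (\rank U); elim: s U => // s IHs U ltUs UT UD ndU.
have [->|U0] := eqVneq U 0.
  exists 0, 0; split; last exact: adds0mx.
  by split; rewrite !mul0mx ?sub0mx.
have [P1 [Q1 [split1 WU ndW W0]]] := splitting_piece UT UD ndU U0.
set W := (P1 + Q1)%MS in WU ndW W0.
have [WT WD] := splitting_sum_stable split1.
pose U' := (orthogonal_mx W :&: U)%MS.
have U'W : 'w(U', W) = 0 by apply/orthogonal_mxP; apply: capmxSl.
have sumU : (W + U' :=: U)%MS.
  apply: eqmx_trans (matrix_modl _ WU) _.
  exact/capmx_idPr/submx_full/nondegenerate_sum_orthogonal.
have U'T : stablemx U' T.
  rewrite sub_capmx (submx_trans (submxMr _ (capmxSr _ _)) UT) andbT.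
  apply/orthogonal_mxP; rewrite -(horner_mx_X T) form_act.
  by apply: form_sub U'W; rewrite ?horner_mx_X.
have U'D : stablemx U' D.
  rewrite sub_capmx (submx_trans (submxMr _ (capmxSr _ _)) UD) andbT.
  apply/orthogonal_mxP; rewrite form_D.
  by rewrite (form_sub _ WD U'W) ?oppr0.
have ndU' : nondegenerate U'.
  move=> v vU' vrad; apply: ndU; first exact: submx_trans vU' (capmxSr _ _).
  have vW : 'w(v, W) = 0 by apply: form_sub U'W.
  by apply: (form_sub (submx_refl v) _ (form_addsmx vW vrad)); rewrite sumU.
have [|P2 [Q2 [split2 sum2]]] := IHs U' _ U'T U'D ndU'.
  rewrite -ltnS; apply: leq_trans ltUs; rewrite ltnS.
  (* If the rank did not drop, [W] would be orthogonal to itself, hence zero. *)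
  rewrite (ltn_leqif (mxrank_leqif_sup (capmxSr _ _))); apply: contra W0 => UU'.
  apply/eqP/row_matrixP=> i; rewrite row0; apply: ndW; first exact: row_sub.
  apply: form_sub U'W => //.
  exact: submx_trans (row_sub i W) (submx_trans WU UU').
have [P2U' Q2U'] : (P2 <= U')%MS /\ (Q2 <= U')%MS.
  by rewrite -!sum2 addsmxSl addsmxSr.
have [[P1T Q1T P1D Q1D] [P1P1 Q1Q1]] := split1.
have [[P2T Q2T P2D Q2D] [P2P2 Q2Q2]] := split2.
exists (P1 + P2)%MS, (Q1 + Q2)%MS; split; last first.
  have -> : ((P1 + P2) + (Q1 + Q2) = W + (P2 + Q2))%MS.
    by rewrite /W -!addsmxA (addsmxA P2) (addsmxC P2) -addsmxA.
  exact: eqmx_trans (adds_eqmx (eqmx_refl W) sum2) sumU.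
have [P21 Q21] : 'w(P2, P1) = 0 /\ 'w(Q2, Q1) = 0.
  by split; apply: form_sub U'W; rewrite ?addsmxSl ?addsmxSr.
by split; [split; rewrite addsmxMr addsmxS | split; apply: (form_addsmx_self J_skew)].
Qed.

End SwappedSplittings.

(** * From an isometry to a splitting into isotropic subspaces *)

Section IsotropicSplittings.
Variable F : fieldType.
Hypothesis two_neq0 : (2 : F) != 0.

Lemma symplectic_swapped_splitting N (J A : 'M[F]_N) :
    J^T = - J -> J \in unitmx -> A \in unitmx -> A *m J *m A^T = J ->
  exists P Q : 'M[F]_N,
    [/\ stablemx P (A + invmx A), stablemx Q (A + invmx A),
        (P *m (A - invmx A) <= Q)%MS & (Q *m (A - invmx A) <= P)%MS] /\
    [/\ P *m J *m P^T = 0, Q *m J *m Q^T = 0 & row_full (P + Q)%MS].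
Proof.
(* The splitting was built in positive dimension, so the zero space is treated apart. *)
case: N J A => [|N] J A Jskew Junit Aunit AJA.
  exists 0, 0; split; first by split; rewrite mul0mx sub0mx.
  by split; rewrite ?mul0mx // /row_full -leqn0 rank_leq_row.
(* Invariance of the form makes [invmx A] the adjoint of [A]. *)
have AJ : A *m J = J *m (invmx A)^T.
  by rewrite -{2}AJA -mulmxA -trmx_mul mulVmx // trmx1 mulmx1.
have A'J : invmx A *m J = J *m A^T.
  by rewrite -{1}AJA !mulmxA mulVmx // mul1mx.
have TJ : (A + invmx A) *m J = J *m (A + invmx A)^T.
  by rewrite linearD /= mulmxDl mulmxDr AJ A'J addrC.
have DJ : (A - invmx A) *m J = - (J *m (A - invmx A)^T).
  by rewrite linearB /= mulmxBl mulmxBr AJ A'J opprB.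
have TD : (A + invmx A) *m (A - invmx A) = (A - invmx A) *m (A + invmx A).
  rewrite !(mulmxDl, mulmxDr, mulmxN, mulNmx) mulmxV // mulVmx //.
  by apply/matrixP=> i j; rewrite !mxE; ring.
have DD : (A - invmx A) *m (A - invmx A) =
    horner_mx (A + invmx A) ('X^2 - 4%:P).
  rewrite rmorphB rmorphXn /= horner_mx_X horner_mx_C expr2 -mulmxE.
  rewrite !(mulmxDl, mulmxDr, mulmxN, mulNmx) mulmxV // mulVmx //.
  by apply/matrixP=> i j; rewrite !mxE; case: (i == j); ring.
have [||v _|P [Q [[st [PP QQ]] sumPQ]]] :=
    swapped_splitting_exists (U := 1%:M) two_neq0 Jskew Junit TJ DJ TD DD.
- by rewrite submx1.
- by rewrite submx1.
- rewrite trmx1 mulmx1 => /eqP; rewrite mulmx_free_eq0 ?row_free_unit //.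
  by move/eqP.
by exists P, Q; split=> //; split=> //; rewrite -sub1mx sumPQ.
Qed.

(** [P] lies in its own orthogonal complement, whose rank is [2n - \rank P]. *)
Lemma isotropic_rank n (J P : 'M[F]_(n + n)) :
  J \in unitmx -> P *m J *m P^T = 0 -> (\rank P <= n)%N.
Proof.
move=> Junit; rewrite -mulmxA => /sub_kermxP/mxrankS.
rewrite mxrank_ker -(mxrank_tr (J *m _)) trmx_mul trmxK mxrankMfree; last first.
  by rewrite row_free_unit unitmx_tr.
move: (\rank P) (rank_leq_row P) => r le_r2n.
by rewrite leq_subRL // !addnn leq_double.
Qed.

Lemma row_base_exists N r (P : 'M[F]_N) : \rank P = r ->
  exists P0 : 'M[F]_(r, N), (P0 :=: P)%MS.
Proof. by move=> <-; exists (row_base P); apply: eq_row_base. Qed.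

End IsotropicSplittings.

(** * The standard symplectic form, adapted bases and the conjugation *)

Lemma Jstd_skew (R : realType) n : (Jstd R n)^T = - Jstd R n.
Proof. by rewrite tr_block_mx opp_block_mx !trmx0 linearN /= trmx1 !oppr0 opprK. Qed.

Lemma Jstd_unit (R : realType) n : Jstd R n \in unitmx.
Proof.
have : Jstd R n *m (- Jstd R n) = 1%:M.
  rewrite mulmxN mulmx_block !mulmx0 !mul0mx mulmx1 mul1mx !addr0 !add0r.
  by rewrite opp_block_mx !opprK !oppr0 -scalar_mx_block.
by case/mulmx1_unit.
Qed.

Lemma symplectic_unit (R : realType) n (A : 'M[R]_(n + n)) :
  symplectic A -> A \in unitmx.
Proof.
move=> sA; have: A^T *m Jstd R n *m A \in unitmx by rewrite sA Jstd_unit.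
by rewrite unitmx_mul => /andP[].
Qed.

Lemma lagrangian_symplectic_basis (R : realType) n (P Q : 'M[R]_(n + n)) :
    P *m Jstd R n *m P^T = 0 -> Q *m Jstd R n *m Q^T = 0 ->
    row_full (P + Q)%MS ->
  exists P0 Q0 : 'M[R]_(n, n + n), [/\ (P0 :=: P)%MS, (Q0 :=: Q)%MS &
    col_mx P0 Q0 *m Jstd R n *m (col_mx P0 Q0)^T = Jstd R n].
Proof.
set J := Jstd R n => PP QQ fullPQ; have Junit : J \in unitmx := Jstd_unit R n.
have rP := isotropic_rank Junit PP; have rQ := isotropic_rank Junit QQ.
have rPQ : (n + n <= \rank P + \rank Q)%N.
  apply: leq_trans (mxrank_adds_leqif P Q).1.
  by rewrite (eqP fullPQ).
have rPn : \rank P = n.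
  by apply/eqP; rewrite eqn_leq rP -(leq_add2r n) (leq_trans rPQ) // leq_add2l.
have rQn : \rank Q = n.
  by apply/eqP; rewrite eqn_leq rQ -(leq_add2l n) (leq_trans rPQ) // leq_add2r.
have [P0 eqP0] := row_base_exists rPn; have [Q0 eqQ0] := row_base_exists rQn.
have iso (B : 'M[R]_(n + n)) (B0 : 'M_(n, n + n)) :
    (B0 :=: B)%MS -> B *m J *m B^T = 0 -> B0 *m J *m B0^T = 0.
  move=> eqB; apply: form_sub; by rewrite eqB.
have P0P0 := iso _ _ eqP0 PP; have Q0Q0 := iso _ _ eqQ0 QQ.
have M0unit : col_mx P0 Q0 \in unitmx.
  by rewrite -row_full_unit -sub1mx -addsmxE (adds_eqmx eqP0 eqQ0) sub1mx.
(* The Gram matrix of [col_mx P0 Q0] has only the blocks [G] and [- G^T], so [G] is invertible, and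
   [(invmx G)^T] turns [Q0] into the basis dual to [P0]. *)
pose G := P0 *m J *m Q0^T.
have Q0P0 : Q0 *m J *m P0^T = - G^T by apply: form_skew; apply: Jstd_skew.
have Gunit : G \in unitmx.
  have: col_mx P0 Q0 *m J *m (col_mx P0 Q0)^T \in unitmx.
    by rewrite !unitmx_mul unitmx_tr M0unit Junit.
  rewrite tr_col_mx mul_col_mx mul_col_row P0P0 Q0Q0 Q0P0 -/G => Bunit.
  have := mulmxV Bunit; rewrite -[invmx _]submxK mulmx_block scalar_mx_block.
  by case/eq_block_mx; rewrite mul0mx add0r => /mulmx1_unit[].
exists P0, ((invmx G)^T *m Q0); split=> //.
  by apply: eqmx_trans eqQ0; apply: eqmxMfull; rewrite row_full_unit unitmx_tr unitmx_inv.
have P0Q1 : P0 *m J *m ((invmx G)^T *m Q0)^T = 1%:M.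
  by rewrite trmx_mul trmxK mulmxA mulmxV.
have Q1P0 : (invmx G)^T *m Q0 *m J *m P0^T = - 1%:M.
  by rewrite (form_skew (Jstd_skew R n) P0) P0Q1 trmx1.
rewrite tr_col_mx mul_col_mx mul_col_row P0P0 P0Q1 Q1P0.
rewrite trmx_mul trmxK !mulmxA -(mulmxA _ Q0) -(mulmxA _ (Q0 *m J)) Q0Q0.
by rewrite mulmx0 mul0mx.
Qed.

Theorem theorem2 (R : realType) (n : nat) (phi : 'M[R]_(n + n)) :
  symplectic phi ->
  exists psi : 'M[R]_(n + n),
    symplectic psi /\ SpR (psi *m phi *m invmx psi).
Proof.
move=> sphi; have two0 : (2 : R) != 0 by rewrite Num.Theory.pnatr_eq0.
(* Vectors are rows, so the isometry to split is [phi^T]. *)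
have Junit := Jstd_unit R n; pose A := phi^T.
have phi_unit := symplectic_unit sphi.
have Aunit : A \in unitmx by rewrite unitmx_tr.
have AJA : A *m Jstd R n *m A^T = Jstd R n by rewrite trmxK.
have [P [Q [[PT QT PD QD] [PP QQ fullPQ]]]] :=
  symplectic_swapped_splitting two0 (Jstd_skew R n) Junit Aunit AJA.
have [P0 [Q0 [eqP0 eqQ0 MJM]]] := lagrangian_symplectic_basis PP QQ fullPQ.
set M := col_mx P0 Q0 in MJM.
have Munit : M \in unitmx.
  have: M *m Jstd R n *m M^T \in unitmx by rewrite MJM.
  by rewrite !unitmx_mul => /andP[/andP[]].
have sub0 (B C : 'M[R]_(n + n)) (B0 C0 : 'M[R]_(n, n + n)) X :
    (B0 :=: B)%MS -> (C0 :=: C)%MS -> (B *m X <= C)%MS ->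
  exists Y, B0 *m X = Y *m C0.
  by move=> eqB eqC sBC; apply/submxP; rewrite eqC (eqmxMr X eqB).
have [X1 eX1] := sub0 _ _ _ _ _ eqP0 eqP0 PT.
have [X2 eX2] := sub0 _ _ _ _ _ eqQ0 eqQ0 QT.
have [Y1 eY1] := sub0 _ _ _ _ _ eqP0 eqQ0 PD.
have [Y2 eY2] := sub0 _ _ _ _ _ eqQ0 eqP0 QD.
have MT : M *m (A + invmx A) *m invmx M = block_mx X1 0 0 X2.
  rewrite mul_col_mx eX1 eX2; apply: (canLR (mulmxK Munit)).
  by rewrite mul_block_col !mul0mx addr0 add0r.
have MD : M *m (A - invmx A) *m invmx M = block_mx 0 Y1 Y2 0.
  rewrite mul_col_mx eY1 eY2; apply: (canLR (mulmxK Munit)).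
  by rewrite mul_block_col !mul0mx addr0 add0r.
pose B := M *m A *m invmx M; pose B' := M *m invmx A *m invmx M.
have BB' : B *m B' = 1%:M.
  by rewrite /B /B' !mulmxA mulmxKV // mulmxK // mulmxV.
have [Bunit _] := mulmx1_unit BB'.
have invB : invmx B = B' by rewrite -[RHS](mulKmx Bunit) BB' mulmx1.
set S := Rrefl R n.
(* [B] and [B'] are half the sum and half the difference of a block diagonal and a block
   antidiagonal matrix; conjugation by [S] negates only the latter. *)
have rev : B = S *m B' *m S.
  move: MT MD; rewrite mulmxDr mulmxBr !(mulmxDl, mulmxBl) mulNmx -/B -/B' => MT MD.
  apply: (scalerI two0).
  have -> : 2 *: B = block_mx X1 Y1 Y2 X2.
    rewrite scaler_nat mulr2n -[X in X + _](subrK B') -addrA [B' + B]addrC MT MD.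
    by rewrite add_block_mx !addr0 !add0r.
  have -> : 2 *: (S *m B' *m S) = S *m (2 *: B') *m S.
    by rewrite -scalemxAr -scalemxAl.
  have -> : 2 *: B' = block_mx X1 (- Y1) (- Y2) X2.
    have -> : 2 *: B' = (B + B') - (B - B').
      by rewrite scaler_nat mulr2n opprB addrC addrA subrK.
    by rewrite MT MD opp_block_mx add_block_mx !oppr0 !addr0 !add0r.
  rewrite !mulmx_block !(mulmx0, mul0mx, mulmx1, mul1mx, addr0, add0r, mulmxN, mulNmx).
  by rewrite !opprK.
have Ssym : S^T = S.
  by rewrite tr_block_mx !trmx0 linearN /= trmx1.
have psiJ : symplectic (invmx M)^T.
  rewrite /symplectic trmxK -{1}MJM !mulmxA mulVmx // mul1mx.
  by rewrite -mulmxA -trmx_mul mulVmx // trmx1 mulmx1.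
(* Transposing back from rows, this matrix conjugates [phi] to [B^T]. *)
exists (invmx M)^T; split=> //.
have def_B : (invmx M)^T *m phi *m invmx (invmx M)^T = B^T.
  by rewrite -trmx_inv invmxK /B !trmx_mul trmxK mulmxA.
rewrite def_B; split; last by rewrite -trmx_inv invB {1}rev !trmx_mul Ssym mulmxA.
rewrite /symplectic trmxK -[RHS]MJM -{2}AJA.
rewrite /symplectic trmxK in psiJ.
by rewrite -{2}psiJ /B !trmx_mul !mulmxA.
Qed.
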